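(* Let $n\geq 1$ be an integer, let $\tau:\mathrm{Mat}_n(\mathbb{C})\to\mathbb{C}$ be the un-normalized trace (so $\tau(I_n)=n$), and let $X\in\mathrm{Mat}_n(\mathbb{C})$ be a self-adjoint matrix with $\tau(X)=0$. A. For any projection $P\in\mathrm{Mat}_n(\mathbb{C})$ with $PX=XP$ and $\tau(P)=1$, there exist self-adjoint elements $A,B\in\mathrm{Mat}_n(\mathbb{C})$ with: - $AB=BA$; - $X=A-B$; - $A\approx B$; - $\max\{\|A\|,\|B\|\}\leq\|X\|$; - $A\perp P$. B. $X$ is an abelian self-commutator in $\mathrm{Mat}_n(\mathbb{C})$.
   Context: Projections are self-adjoint idempotents and $\|\cdot\|$ is the operator (C*-)norm. For elements of a unital C*-algebra $\mathcal{A}$: $A\approx B$ means $B=UAU^*$ for some unitary $U\in\mathcal{A}$; $A\perp B$ means $AB=BA=AB^*=B^*A=0$. A self-adjoint element $A\in\mathcal{A}$ is an abelian self-commutator in $\mathcal{A}$ if there is $Z\in\mathcal{A}$ with $A=ZZ^*-Z^*Z$ and $(ZZ^* )(Z^*Z)=(Z^*Z)(ZZ^* )$. *)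

(* Defs.v *)
From mathcomp Require Export all_boot all_order all_algebra.
From mathcomp Require Export spectral sesquilinear.
From mathcomp Require Export classical_sets reals complex.

Set Implicit Arguments.
Unset Strict Implicit.
Unset Printing Implicit Defensive.

Import Order.TTheory GRing.Theory Num.Theory.

Local Open Scope ring_scope.
Local Open Scope complex_scope.
Local Open Scope sesquilinear_scope.
Local Open Scope classical_set_scope.

Definition l2norm (R : realType) (n : nat) (v : 'cV[R[i]]_n) : R :=
  Num.sqrt (\sum_(i < n) Normc.normc (v i ord0) ^+ 2).

(* In finite dimension this set of reals is nonempty and bounded, so [sup] is
   its genuine least upper bound and not the default value 0. *)
Definition opnorm (R : realType) (n : nat) (A : 'M[R[i]]_n) : R :=
  sup [set l2norm (A *m v) | v in [set v : 'cV[R[i]]_n | l2norm v <= 1]].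

Definition projection (R : realType) (n : nat) (P : 'M[R[i]]_n) : Prop :=
  P \is hermsymmx /\ P *m P = P.

Definition unitarily_equivalent (R : realType) (n : nat) (A B : 'M[R[i]]_n) :
    Prop :=
  exists2 U : 'M[R[i]]_n, U \is unitarymx & B = U *m A *m U^t*.

Definition orthogonal_elements (R : realType) (n : nat) (A B : 'M[R[i]]_n) :
    Prop :=
  [/\ A *m B = 0, B *m A = 0, A *m B^t* = 0 & B^t* *m A = 0].

Definition abelian_self_commutator (R : realType) (n : nat) (A : 'M[R[i]]_n) :
    Prop :=
  A \is hermsymmx /\
  exists Z : 'M[R[i]]_n,
    A = Z *m Z^t* - Z^t* *m Z /\
    (Z *m Z^t*) *m (Z^t* *m Z) = (Z^t* *m Z) *m (Z *m Z^t*).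

(* Main.v *)
Require Import Defs.
From mathcomp Require Import perm ring lra.
Import Order.TTheory GRing.Theory Num.Theory.
Local Open Scope ring_scope.
Local Open Scope complex_scope.

(** Two commuting self-adjoint matrices [X] and [P] are diagonalised by one
    unitary matrix ([codiagonalization]), because [X + 'i *: P] is normal.
    So let [X] be diagonal with real eigenvalues [x i] of sum zero, and let
    [P], a projection of trace one, be the projection onto the basis vector
    of some index [i0] ([rank1_diag]).

    What is left is a rearrangement problem for real numbers, solved by
    [balanced_perm]: find [a] and a permutation [s] with
    [x i = a i - a (s i)], [a i0 = 0] and [`|a i| <= M], where [M] bounds all
    the [`|x i|].  Enumerate the indices cyclically from [i0], let [s] be the
    successor, and let [- a i] be the sum of the [x k] for [k] strictly
    before [i]; the sum of all [x k] being zero, the relation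
    [x i = a i - a (s i)] also holds at the last index.  An order for which
    these partial sums stay in [[-M, M]] is found greedily ([balanced_seq]):
    as long as the partial sum is [S], the remaining terms add up to [- S],
    so one of them has the sign opposite to that of [S] (or is zero), and
    adding it does not leave [[-M, M]].

    Then [A = diag (a i)] and [B = diag (a (s i))] are conjugate under the
    permutation matrix of [s], [X = A - B], [A] vanishes on the range of [P],
    and [M] can be taken to be the norm of [X], since the norm of a diagonal
    matrix is the largest modulus of its entries ([opnorm_rdiag_le],
    [opnorm_rdiag_ge]).

    For the self-commutator, shift [A] and [B] by the scalar [M]: they become
    positive, their difference is unchanged, and they are still conjugate by
    a unitary [W].  With [Z = sqrt (A + M) W^*] one gets [Z Z^* = A + M] and
    [Z^* Z = B + M], which commute, being diagonal. *)

Set Implicit Arguments.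
Unset Strict Implicit.

(** * Rearranging real numbers of sum zero *)

(** Numbers bounded by [M] can be ordered so that the partial sums, started at
    a value [s] that cancels their total, never leave [[-M, M]]. *)
Lemma balanced_seq (R : realFieldType) (I : eqType) (x : I -> R) (M : R)
    (xM : forall i, `|x i| <= M) (r : seq I) (s : R) :
  `|s| <= M -> s + \sum_(i <- r) x i = 0 ->
  exists2 t, perm_eq t r &
    forall k, `|s + \sum_(i <- take k t) x i| <= M.
Proof.
have [m] := ubnP (size r); elim: m r s => // m IHm r s.
case: (altP (r =P [::])) => [-> _ sM _|rN0 size_r sM sum0].
  by exists [::] => // k; rewrite /= big_nil addr0.
have [j jr sxj] : exists2 j, j \in r & s * x j <= 0.
  have [/hasP[j]|/hasPn noj] := boolP (has (fun j => s * x j <= 0) r).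
    by exists j.
  (* Otherwise the sum of the [s * x i], which is [- s ^+ 2], is positive. *)
  have : 0 < \sum_(i <- r) s * x i.
    case: r rN0 noj {size_r sum0} => // i r _ noj.
    rewrite big_cons ltr_wpDr ?ltNge ?noj ?mem_head //.
    rewrite big_seq sumr_ge0 // => k kr; rewrite ltW // ltNge noj //.
    by rewrite in_cons kr orbT.
  by rewrite -mulr_sumr; nra.
have [|||t' t'r t'M] := IHm (rem j r) (s + x j).
- by rewrite size_rem //; case: (r) rN0 size_r.
- by move: sM (xM j); rewrite !ler_norml; nra.
- by rewrite -addrA -(big_rem j (F := x) (P := xpredT) jr).
exists (j :: t').
  by rewrite perm_sym (permPl (perm_to_rem jr)) perm_cons perm_sym.
case=> [|k] /=; first by rewrite big_nil addr0.
by rewrite big_cons addrA.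
Qed.

Lemma balanced_perm (R : realFieldType) (n : nat) (x : 'I_n -> R) (M : R)
    (i0 : 'I_n) :
  (forall i, `|x i| <= M) -> \sum_i x i = 0 ->
  exists (s : 'S_n) (a : 'I_n -> R),
    [/\ a i0 = 0, forall i, `|a i| <= M & forall i, x i = a i - a (s i)].
Proof.
move=> xM x0; pose r := rem i0 (enum 'I_n).
have enumE : perm_eq (enum 'I_n) (i0 :: r) by rewrite perm_to_rem ?mem_enum.
have [||t tr tM] := @balanced_seq R _ x M xM r (x i0); first exact: xM.
  by rewrite -(big_cons _ _ i0 r xpredT x) -(perm_big _ enumE) /= big_enum.
pose p := i0 :: t.
have pE : perm_eq p (enum 'I_n).
  by rewrite perm_sym (permPl enumE) perm_cons perm_sym.
have p_uniq : uniq p by rewrite (perm_uniq pE) enum_uniq.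
have mem_p i : i \in p by rewrite (perm_mem pE) mem_enum.
have next_inj : injective (next p) := can_inj (prev_next p_uniq).
pose a i := - \sum_(k <- take (index i p) p) x k.
(* [s] is the cyclic successor along [p], which begins at [i0]. *)
exists (perm next_inj), a; split=> [|i|i].
- by rewrite /a /= eqxx /= big_nil oppr0.
- rewrite /a normrN; case: (index i p) => [|k] /=.
    by rewrite big_nil normr0 (le_trans _ (xM i0)).
  by rewrite big_cons.
have ltip : (index i p < size p)%N by rewrite index_mem.
have sum_iS : \sum_(k <- take (index i p).+1 p) x k =
    \sum_(k <- take (index i p) p) x k + x i.
  by rewrite (take_nth i0) // nth_index // -cats1 big_cat big_seq1.
suff sum_next : \sum_(k <- take (index (next p i) p) p) x k =
    \sum_(k <- take (index i p).+1 p) x k.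
  by rewrite /a permE sum_next sum_iS; ring.
have -> : next p i = nth i0 t (index i p) by rewrite next_nth mem_p.
move: ltip; rewrite -[size p]/(size t).+1 ltnS leq_eqVlt => /orP[/eqP it|it].
  (* The successor of the last element is [i0], and the total sum is 0. *)
  rewrite it nth_default // {1}/p index_head take0 big_nil.
  rewrite take_oversize //.
  by rewrite (perm_big _ pE) /= big_enum.
have -> : nth i0 t (index i p) = nth i0 p (index i p).+1 by [].
by rewrite index_uniq.
Qed.

(** * Simultaneous unitary diagonalisation *)

Local Open Scope sesquilinear_scope.

Lemma trmxC_mul (C : numClosedFieldType) (m n p : nat) (A : 'M[C]_(m, n))
    (B : 'M[C]_(n, p)) : (A *m B)^t* = B^t* *m A^t*.
Proof. by rewrite trmx_mul map_mxM. Qed.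

Lemma hermsymmxP (C : numClosedFieldType) (n : nat) (A : 'M[C]_n) :
  reflect (A^t* = A) (A \is hermsymmx).
Proof.
rewrite is_hermitianmxE expr0 scale1r eq_sym; exact: eqP.
Qed.

Lemma unitarymxPV (C : numClosedFieldType) (n : nat) (U : 'M[C]_n) :
  U \is unitarymx -> U^t* *m U = 1%:M.
Proof. by move=> /unitarymxP /mulmx1C. Qed.

(** The matrix [U^* diag(d) U]; for unitary [U], the matrix whose entries in
    the orthonormal basis given by [U] are [d] on the diagonal, 0 elsewhere. *)
Definition udiag (C : numClosedFieldType) (n : nat) (U : 'M[C]_n)
    (d : 'I_n -> C) : 'M[C]_n :=
  U^t* *m diag_mx (\row_j d j) *m U.

Lemma udiag_herm (C : numClosedFieldType) (n : nat) (U : 'M[C]_n)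
    (d : 'I_n -> C) : (forall i, d i \is Num.real) -> udiag U d \is hermsymmx.
Proof.
move=> d_real; apply/hermsymmxP.
rewrite /udiag !trmxC_mul trmxCK mulmxA; congr (_ *m _ *m _).
apply/matrixP=> i j; rewrite !mxE rmorphMn /= (CrealP (d_real _)) eq_sym.
by case: eqP => [->|].
Qed.

Lemma udiagB (C : numClosedFieldType) (n : nat) (U : 'M[C]_n)
    (d e : 'I_n -> C) :
  udiag U d - udiag U e = udiag U (fun i => d i - e i).
Proof.
rewrite /udiag -mulmxBl -mulmxBr; congr (_ *m _ *m _).
by apply/matrixP=> i j; rewrite !mxE mulrnBl.
Qed.

Lemma udiagM (C : numClosedFieldType) (n : nat) (U : 'M[C]_n)
    (d e : 'I_n -> C) : U \is unitarymx ->
  udiag U d *m udiag U e = udiag U (fun i => d i * e i).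
Proof.
move=> Uu; rewrite /udiag 2!mulmxA (mulmxtVK _ Uu) -(mulmxA (U^t*)) mulmx_diag.
congr (_ *m diag_mx _ *m _).
by apply/rowP=> j; rewrite !mxE.
Qed.

Lemma eq_udiag (C : numClosedFieldType) (n : nat) (U : 'M[C]_n)
    (d e : 'I_n -> C) : d =1 e -> udiag U d = udiag U e.
Proof.
move=> de; congr (_ *m diag_mx _ *m _).
by apply/rowP=> j; rewrite !mxE de.
Qed.

Lemma udiag0 (C : numClosedFieldType) (n : nat) (U : 'M[C]_n)
    (d : 'I_n -> C) : d =1 (fun=> 0) -> udiag U d = 0.
Proof.
move=> d0; rewrite /udiag (_ : \row_j _ = 0) ?linear0 ?mulmx0 ?mul0mx //.
by apply/rowP=> j; rewrite !mxE d0.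
Qed.

Lemma udiag_inj (C : numClosedFieldType) (n : nat) (U : 'M[C]_n)
    (d e : 'I_n -> C) : U \is unitarymx -> udiag U d = udiag U e -> d =1 e.
Proof.
move=> Uu dUe i.
have /matrixP/(_ i i) : U *m udiag U d *m U^t* = U *m udiag U e *m U^t*.
  by rewrite dUe.
rewrite /udiag !mulmxA !mulmxtVK // !(unitarymxP _) // !mul1mx !mxE eqxx.
by rewrite !mulr1n.
Qed.

Lemma udiag_trace (C : numClosedFieldType) (n : nat) (U : 'M[C]_n)
    (d : 'I_n -> C) : U \is unitarymx -> \tr (udiag U d) = \sum_i d i.
Proof.
move=> Uu; rewrite /udiag mxtrace_mulC mulmxA (unitarymxP _) // mul1mx.
by rewrite mxtrace_diag; apply: eq_bigr => i _; rewrite mxE.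
Qed.

(** Permuting the eigenvalues is a unitary conjugation, by a unitary that
    depends on the permutation only. *)
Lemma udiag_perm (C : numClosedFieldType) (n : nat) (U : 'M[C]_n) (s : 'S_n) :
  U \is unitarymx ->
  exists2 W : 'M[C]_n, W \is unitarymx &
    forall d, udiag U (d \o s) = W *m udiag U d *m W^t*.
Proof.
move=> Uu; pose Q : 'M[C]_n := perm_mx s.
have QC : Q^t* = Q^T by apply/matrixP=> i j; rewrite !mxE rmorph_nat.
have Qu : Q \is unitarymx.
  by apply/unitarymxP; rewrite QC tr_perm_mx -perm_mxM mulgV perm_mx1.
exists (U^t* *m Q *m U) => [|d].
  by rewrite !mul_unitarymx // trmxC_unitary.
rewrite /udiag !trmxC_mul trmxCK !mulmxA !mulmxtVK //; congr (_ *m _).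
rewrite -!mulmxA; congr (_ *m _).
rewrite QC tr_perm_mx mulmxA -row_permE -col_permE.
apply/matrixP=> i j; rewrite !mxE /= (inj_eq perm_inj).
by case: eqP => [->|].
Qed.

Lemma trmxC_cartesian (C : numClosedFieldType) (n : nat) (X Y : 'M[C]_n) :
  X \is hermsymmx -> Y \is hermsymmx ->
  (X + 'i%R *: Y)^t* = X - 'i%R *: Y.
Proof.
move=> /hermsymmxP hX /hermsymmxP hY; rewrite -[in RHS]hX -[in RHS]hY.
by apply/matrixP=> i j; rewrite !mxE rmorphD rmorphM /= conjCi mulNr.
Qed.

(** Uniqueness of the real and imaginary parts of a matrix. *)
Lemma herm_cartesian_inj (C : numClosedFieldType) (n : nat)
    (X Y X' Y' : 'M[C]_n) :
  X \is hermsymmx -> Y \is hermsymmx -> X' \is hermsymmx -> Y' \is hermsymmx ->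
  X + 'i%R *: Y = X' + 'i%R *: Y' -> X = X' /\ Y = Y'.
Proof.
move=> hX hY hX' hY' e.
have e' : X - 'i%R *: Y = X' - 'i%R *: Y'.
  by rewrite -!trmxC_cartesian // e.
have dbl (M N : 'M[C]_n) : M + M = N + N -> M = N.
  rewrite -!mulr2n -!scaler_nat; apply: scalerI.
  by rewrite pnatr_eq0.
have sumE (M N : 'M[C]_n) : (M + N) + (M - N) = M + M.
  by rewrite addrACA subrr addr0.
have subE (M N : 'M[C]_n) : (M + N) - (M - N) = N + N.
  by rewrite opprD opprK addrACA subrr add0r.
split; first by apply: dbl; rewrite -(sumE X ('i%R *: Y)) e e' sumE.
apply: (@scalerI _ _ 'i%R); first exact: neq0Ci.
by apply: dbl; rewrite -(subE X) e e' subE.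
Qed.

(** The normal matrix [X + 'i *: Y] is unitarily diagonalisable; the real and
    imaginary parts of its eigenvalues diagonalise [X] and [Y]. *)
Lemma codiagonalization (C : numClosedFieldType) (n : nat) (X Y : 'M[C]_n) :
  X \is hermsymmx -> Y \is hermsymmx -> X *m Y = Y *m X ->
  exists2 U : 'M[C]_n, U \is unitarymx &
    exists2 d : 'I_n -> C, X = udiag U (fun i => 'Re (d i)) &
      Y = udiag U (fun i => 'Im (d i)).
Proof.
move=> hX hY XY; pose N := X + 'i%R *: Y.
have /orthomx_spectralP : N \is normalmx.
  apply/normalmxP; rewrite trmxC_cartesian // /N.
  have XZ : X *m ('i%R *: Y) = 'i%R *: Y *m X.
    by rewrite -scalemxAr XY scalemxAl.
  rewrite !mulmxDl !mulmxDr !mulNmx !mulmxN XZ !addrA.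
  by rewrite addrNK addrK.
set U := spectralmx N; set D := spectral_diag N => NE.
have Uu : U \is unitarymx by exact: spectral_unitarymx.
exists U => //.
suff [-> ->] : X = udiag U (fun i => 'Re (D 0 i)) /\
               Y = udiag U (fun i => 'Im (D 0 i)) by exists (D 0).
apply: herm_cartesian_inj => //.
- by apply: udiag_herm => i; apply: Creal_Re.
- by apply: udiag_herm => i; apply: Creal_Im.
rewrite -/N NE invmx_unitary // /udiag scalemxAl scalemxAr -mulmxDl -mulmxDr.
congr (_ *m _ *m _); apply/matrixP=> i j; rewrite !mxE mulrnAr -mulrnDl.
by rewrite -Crect.
Qed.

(** * Real eigenvalues *)

(** [udiag] for real eigenvalues: the self-adjoint matrix with eigenvalues [x]
    in the orthonormal basis given by [U]. *)
Definition rdiag (R : realType) (n : nat) (U : 'M[R[i]]_n) (x : 'I_n -> R) :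
    'M[R[i]]_n :=
  udiag U (fun i => (x i)%:C).

Lemma real_complex_real (R : realType) (x : R) : x%:C \is Num.real.
Proof. by rewrite complex_real. Qed.

Lemma rdiag_herm (R : realType) (n : nat) (U : 'M[R[i]]_n) (x : 'I_n -> R) :
  rdiag U x \is hermsymmx.
Proof. by apply: udiag_herm => i; apply: real_complex_real. Qed.

Lemma eq_rdiag (R : realType) (n : nat) (U : 'M[R[i]]_n) (x y : 'I_n -> R) :
  x =1 y -> rdiag U x = rdiag U y.
Proof. by move=> xy; apply: eq_udiag => i; rewrite xy. Qed.

Lemma rdiagB (R : realType) (n : nat) (U : 'M[R[i]]_n) (x y : 'I_n -> R) :
  rdiag U x - rdiag U y = rdiag U (fun i => x i - y i).
Proof. by rewrite /rdiag udiagB; apply: eq_udiag => i; rewrite rmorphB. Qed.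

Lemma rdiagM (R : realType) (n : nat) (U : 'M[R[i]]_n) (x y : 'I_n -> R) :
  U \is unitarymx -> rdiag U x *m rdiag U y = rdiag U (fun i => x i * y i).
Proof.
move=> Uu; apply: etrans (udiagM _ _ Uu) _; apply: eq_udiag => i.
exact/esym/rmorphM.
Qed.

Lemma rdiag_comm (R : realType) (n : nat) (U : 'M[R[i]]_n) (x y : 'I_n -> R) :
  U \is unitarymx -> rdiag U x *m rdiag U y = rdiag U y *m rdiag U x.
Proof.
move=> Uu; apply: etrans (rdiagM x y Uu) _.
by apply: etrans (esym (rdiagM y x Uu)); apply: eq_rdiag => i; apply: mulrC.
Qed.

Lemma rdiag0 (R : realType) (n : nat) (U : 'M[R[i]]_n) (x : 'I_n -> R) :
  x =1 (fun=> 0) -> rdiag U x = 0.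
Proof. by move=> x0; apply: udiag0 => i; rewrite x0. Qed.

Lemma rdiag_inj (R : realType) (n : nat) (U : 'M[R[i]]_n) (x y : 'I_n -> R) :
  U \is unitarymx -> rdiag U x = rdiag U y -> x =1 y.
Proof. by move=> Uu e i; apply: complexI; apply: (udiag_inj Uu e i). Qed.

Lemma rdiag_trace (R : realType) (n : nat) (U : 'M[R[i]]_n) (x : 'I_n -> R) :
  U \is unitarymx -> \tr (rdiag U x) = (\sum_i x i)%:C.
Proof. by move=> Uu; rewrite udiag_trace // rmorph_sum. Qed.

Lemma rdiag_perm (R : realType) (n : nat) (U : 'M[R[i]]_n) (s : 'S_n) :
  U \is unitarymx ->
  exists2 W : 'M[R[i]]_n, W \is unitarymx &
    forall x, rdiag U (x \o s) = W *m rdiag U x *m W^t*.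
Proof.
move=> Uu; have [W Wu WE] := udiag_perm s Uu.
by exists W => // x; rewrite -[RHS]WE.
Qed.

Lemma rcodiagonalization (R : realType) (n : nat) (X Y : 'M[R[i]]_n) :
  X \is hermsymmx -> Y \is hermsymmx -> X *m Y = Y *m X ->
  exists2 U : 'M[R[i]]_n, U \is unitarymx &
    exists x y : 'I_n -> R, X = rdiag U x /\ Y = rdiag U y.
Proof.
move=> hX hY XY; have [U Uu [d XE YE]] := codiagonalization hX hY XY.
exists U => //; exists (fun i => complex.Re (d i)), (fun i => complex.Im (d i)).
by split; [rewrite XE|rewrite YE]; apply: eq_udiag => i;
  rewrite ?complexRe ?complexIm.
Qed.

(** * Operator norm of a diagonalised matrix *)

Lemma l2norm_ge0 (R : realType) (n : nat) (v : 'cV[R[i]]_n) : 0 <= l2norm v.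
Proof. exact: sqrtr_ge0. Qed.

Lemma l2norm_sqr (R : realType) (n : nat) (v : 'cV[R[i]]_n) :
  l2norm v ^+ 2 = \sum_i Normc.normc (v i ord0) ^+ 2.
Proof. by rewrite sqr_sqrtr // sumr_ge0 // => i _; rewrite sqr_ge0. Qed.

Lemma l2norm_form (R : realType) (n : nat) (v : 'cV[R[i]]_n) :
  (l2norm v ^+ 2)%:C = (v^t* *m v) ord0 ord0.
Proof.
rewrite l2norm_sqr mxE rmorph_sum; apply: eq_bigr => i _.
by rewrite !mxE rmorphXn mulrC -normCK.
Qed.

Lemma l2norm_unitary (R : realType) (n : nat) (U : 'M[R[i]]_n)
    (v : 'cV[R[i]]_n) : U \is unitarymx -> l2norm (U *m v) = l2norm v.
Proof.
move=> Uu; apply/(@pexpIrn _ 2); rewrite ?nnegrE ?l2norm_ge0 //.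
apply: complexI; rewrite !l2norm_form trmxC_mul -mulmxA (mulmxA _ U).
by rewrite unitarymxPV // mul1mx.
Qed.

Lemma l2norm_rdiag (R : realType) (n : nat) (U : 'M[R[i]]_n) (d : 'I_n -> R)
    (v : 'cV[R[i]]_n) : U \is unitarymx ->
  l2norm (rdiag U d *m v) ^+ 2 =
    \sum_i d i ^+ 2 * Normc.normc ((U *m v) i ord0) ^+ 2.
Proof.
move=> Uu; rewrite /rdiag /udiag -!mulmxA l2norm_unitary ?trmxC_unitary //.
rewrite l2norm_sqr; apply: eq_bigr => i _.
rewrite mul_diag_mx !mxE Normc.normcM exprMn; congr (_ * _).
by rewrite /= expr0n addr0 sqrtr_sqr real_normK // num_real.
Qed.

Lemma l2norm_rdiag_le (R : realType) (n : nat) (U : 'M[R[i]]_n) (d : 'I_n -> R)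
    (M : R) (v : 'cV[R[i]]_n) : U \is unitarymx -> 0 <= M ->
  (forall i, `|d i| <= M) -> l2norm v <= 1 -> l2norm (rdiag U d *m v) <= M.
Proof.
move=> Uu M0 dM v1; rewrite -(@ler_pXn2r _ 2) ?nnegrE ?l2norm_ge0 //.
rewrite l2norm_rdiag //.
apply: (@le_trans _ _ (M ^+ 2 * l2norm v ^+ 2)).
  rewrite -(l2norm_unitary v Uu) l2norm_sqr mulr_sumr.
  apply: ler_sum => i _; rewrite ler_wpM2r ?sqr_ge0 // -real_normK ?num_real //.
  by rewrite ler_pXn2r ?nnegrE.
by rewrite ler_piMr ?sqr_ge0 // expr_le1 // l2norm_ge0.
Qed.

Lemma opnorm_rdiag_le (R : realType) (n : nat) (U : 'M[R[i]]_n) (d : 'I_n -> R)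
    (M : R) : U \is unitarymx -> 0 <= M -> (forall i, `|d i| <= M) ->
  opnorm (rdiag U d) <= M.
Proof.
move=> Uu M0 dM; apply: ge_sup => [|_ [v v1 <-]]; last exact: l2norm_rdiag_le.
exists (l2norm (rdiag U d *m 0)), 0 => //=.
rewrite /l2norm big1 ?sqrtr0 ?ler01 // => i _.
by rewrite mxE Normc.normc0 expr0n.
Qed.

(** The eigenvector [U^* e_k] has norm 1 and is stretched by [`|d k|]. *)
Lemma opnorm_rdiag_ge (R : realType) (n : nat) (U : 'M[R[i]]_n) (d : 'I_n -> R)
    (k : 'I_n) : U \is unitarymx -> `|d k| <= opnorm (rdiag U d).
Proof.
move=> Uu; pose e : 'cV[R[i]]_n := delta_mx k ord0.
have eE (f : 'I_n -> R) :
    \sum_i f i * Normc.normc (e i ord0) ^+ 2 = f k.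
  rewrite (bigD1 k) //= big1 => [|i ik].
    by rewrite mxE !eqxx Normc.normc1 expr1n mulr1 addr0.
  by rewrite mxE (negPf ik) Normc.normc0 expr0n mulr0.
have e1 : l2norm e = 1.
  apply/(@pexpIrn _ 2); rewrite ?nnegrE ?l2norm_ge0 ?ler01 //.
  rewrite l2norm_sqr expr1n -[RHS](eE (fun=> 1)).
  by apply: eq_bigr => i _; rewrite mul1r.
apply: ub_le_sup.
  (* The sum of all [`|d i|] is a crude bound on the set in [opnorm]. *)
  exists (\sum_i `|d i|) => _ [v v1 <-].
  apply: l2norm_rdiag_le => //; first exact: sumr_ge0.
  by move=> i; rewrite (bigD1 i) //= lerDl sumr_ge0.
exists (U^t* *m e); first by rewrite /= l2norm_unitary ?trmxC_unitary ?e1.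
apply/(@pexpIrn _ 2); rewrite ?nnegrE ?l2norm_ge0 //.
rewrite l2norm_rdiag // mulmxA (unitarymxP _) // mul1mx eE.
by rewrite real_normK ?num_real.
Qed.

(** * Decomposition of a self-adjoint matrix of trace zero *)

(** The eigenvalues of a projection of trace one are 1 at one index and 0 at
    all the others. *)
Lemma rank1_diag (R : realDomainType) (n : nat) (p : 'I_n -> R) :
  (forall i, p i * p i = p i) -> \sum_i p i = 1 ->
  exists i0, forall i, p i = (i == i0)%:R.
Proof.
move=> pp p1.
have p01 i : p i = 0 \/ p i = 1.
  have /eqP : p i * (p i - 1) = 0 by rewrite mulrBr mulr1 pp subrr.
  by rewrite mulf_eq0 subr_eq0 => /orP[] /eqP; [left|right].
have p_ge0 i : 0 <= p i by rewrite -pp -expr2 sqr_ge0.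
have [i0 /eqP pi0|no] := pickP (fun i => p i == 1); last first.
  move: p1; rewrite big1 => [/esym/eqP|i _]; first by rewrite oner_eq0.
  by case: (p01 i) => // /eqP; rewrite no.
exists i0 => i; have [->|ii0] := eqVneq i i0; first exact: pi0.
apply/eqP; move: p1; rewrite (bigD1 i0) //= pi0 => /eqP.
rewrite -[X in _ == X]addr0 (inj_eq (addrI _)) psumr_eq0 // => /allP/(_ i).
by rewrite mem_index_enum ii0; apply.
Qed.

(** [balanced_perm] for the eigenvalues of a matrix, with its operator norm as
    the bound. *)
Lemma balanced_rdiag (R : realType) (n : nat) (U : 'M[R[i]]_n) (x : 'I_n -> R)
    (i0 : 'I_n) : U \is unitarymx -> \tr (rdiag U x) = 0 ->
  exists (s : 'S_n) (a : 'I_n -> R),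
    [/\ a i0 = 0, forall i, `|a i| <= opnorm (rdiag U x) &
        rdiag U x = rdiag U a - rdiag U (a \o s)].
Proof.
move=> Uu tr0; have x0 : \sum_i x i = 0.
  by apply: complexI; rewrite -(rdiag_trace x Uu) tr0.
have [s [a [ai0 aM xE]]] := @balanced_perm R n x _ i0
  (fun i => opnorm_rdiag_ge x i Uu) x0.
by exists s, a; split=> //; rewrite rdiagB; apply: eq_rdiag.
Qed.

Unset Implicit Arguments.

Theorem theorem2p1 (R : realType) (n : nat) (n_ge1 : (1 <= n)%N)
    (X : 'M[R[i]]_n) (X_sa : X \is hermsymmx) (X_tr : \tr X = 0) :
  (forall P : 'M[R[i]]_n,
     projection P -> P *m X = X *m P -> \tr P = 1 ->
     exists A B : 'M[R[i]]_n,
       (A \is hermsymmx) /\ (B \is hermsymmx) /\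
       A *m B = B *m A /\
       X = A - B /\
       unitarily_equivalent A B /\
       Num.max (opnorm A) (opnorm B) <= opnorm X /\
       orthogonal_elements A P) /\
  abelian_self_commutator X.
Proof.
split=> [P [P_sa PP] PX P_tr|].
  have [U Uu [x [p [XE PE]]]] := rcodiagonalization X_sa P_sa (esym PX).
  have [i0 pE] : exists i0, forall i, p i = (i == i0)%:R.
    apply: rank1_diag.
      by apply: (rdiag_inj Uu); rewrite -(rdiagM p p Uu) -PE.
    by apply: complexI; rewrite -(rdiag_trace p Uu) -PE.
  rewrite XE in X_tr.
  have [s [a [ai0 aM XAB]]] := balanced_rdiag i0 Uu X_tr.
  rewrite -XE in XAB aM.
  have X_ge0 : 0 <= opnorm X by exact: le_trans (aM i0).
  have ap i : a i * p i = 0.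
    by rewrite pE; case: eqP => [->|_]; rewrite ?ai0 ?mul0r ?mulr0.
  exists (rdiag U a), (rdiag U (a \o s)).
  split; first exact: rdiag_herm.
  split; first exact: rdiag_herm.
  split; first exact: rdiag_comm.
  split; first exact: XAB.
  split; first by have [W Wu WE] := rdiag_perm s Uu; exists W; last exact: WE.
  split.
    rewrite ge_max; apply/andP; split; apply: (opnorm_rdiag_le Uu X_ge0) => i;
      exact: aM.
  have AP : rdiag U a *m P = 0 by rewrite PE (rdiagM a p Uu) (rdiag0 _ ap).
  have PA : P *m rdiag U a = 0 by rewrite PE (rdiag_comm p a Uu) -PE.
  by rewrite /orthogonal_elements (hermsymmxP _ P_sa).
have [U Uu [x [_ [XE _]]]] := rcodiagonalization X_sa X_sa erefl.
split=> //; rewrite XE in X_tr.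
have [s [a [_ aM XAB]]] := balanced_rdiag (Ordinal n_ge1) Uu X_tr.
rewrite -XE in XAB aM.
(* The shift by the norm makes the eigenvalues [b] nonnegative. *)
pose b i := a i + opnorm X; pose r i := Num.sqrt (b i).
have rE i : r i * r i = b i.
  rewrite -expr2 sqr_sqrtr // /b; move: (aM i); rewrite ler_norml; lra.
have [W Wu WE] := rdiag_perm s Uu.
pose Z := rdiag U r *m W^t*.
have r_sa := hermsymmxP _ (rdiag_herm U r).
have ZZ : Z *m Z^t* = rdiag U b.
  rewrite trmxC_mul trmxCK r_sa mulmxA (mulmxKtV _ Wu erefl) (rdiagM r r Uu).
  exact: eq_rdiag.
have ZZ' : Z^t* *m Z = rdiag U (b \o s).
  rewrite trmxC_mul trmxCK r_sa mulmxA -(mulmxA W) (rdiagM r r Uu) WE.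
  by rewrite (eq_rdiag U rE).
exists Z; rewrite ZZ ZZ'; split.
  apply: etrans XAB _; apply: etrans (rdiagB _ _ _) _.
  apply: etrans (esym (rdiagB _ _ _)).
  by apply: eq_rdiag => i; rewrite /b /=; ring.
exact: rdiag_comm.
Qed.
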